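(* Let $m$, $n$ and $q$ be positive integers such that $n$ is odd and $q$ is even. Then \[ \sum_{k = 1}^\infty \frac{\prod_{j=1}^{m-1} F_{nk+jnq}}{\prod_{j=0}^{m} L_{nk+jnq}} = \frac{1}{2F_{mnq}}\sum_{k=1}^{q}\left[(-1)^{k-1}\prod_{j=0}^{m-1}\frac{F_{nk+jnq}}{L_{nk+jnq}}\right]. \]
   Context: The Fibonacci numbers are defined by $F_0=0$, $F_1=1$, $F_n=F_{n-1}+F_{n-2}$, and the Lucas numbers by $L_0=2$, $L_1=1$, $L_n=L_{n-1}+L_{n-2}$. Infinite sums are limits of partial sums. Empty products equal $1$ (in particular $\prod_{j=1}^{0}=1$). *)

(* Defs.v *)
From mathcomp Require Import all_boot.

Set Implicit Arguments.
Unset Strict Implicit.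
Unset Printing Implicit Defensive.

Fixpoint fib (n : nat) : nat :=
  match n with
  | 0 => 0
  | n1.+1 => match n1 with 0 => 1 | n2.+1 => fib n1 + fib n2 end
  end.

Fixpoint lucas (n : nat) : nat :=
  match n with
  | 0 => 2
  | n1.+1 => match n1 with 0 => 1 | n2.+1 => lucas n1 + lucas n2 end
  end.

(* Main.v *)
Require Import Defs.
From mathcomp Require Import all_boot all_order all_algebra.
From mathcomp Require Import all_classical all_reals all_analysis.
From mathcomp Require Import zify ring.
Import Order.TTheory GRing.Theory Num.Theory.
Import numFieldNormedType.Exports.
Local Open Scope classical_set_scope.
Local Open Scope ring_scope.

(** Put [T k] for the product on the right-hand side.  D'Ocagne's identity
    [F (a + d) * L a - F a * L (a + d) = 2 (-1)^a F d] shows that the [k]-th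
    term of the series is [(-1)^k (T (k + q) - T k) / (2 F (m n q))].  As [q]
    is even, the partial sum up to [N] telescopes to the claimed value plus a
    multiple of the sum of [(-1)^k T k] over [N < k <= N + q].  Since
    [5 F^2 = L^2 - 4 (-1)^a], [F / L] converges, hence so does [T], and an
    alternating sum of evenly many consecutive values of [T] tends to [0]. *)

Lemma fibSS n : fib n.+2 = (fib n.+1 + fib n)%N.
Proof. by []. Qed.

Lemma lucasSS n : lucas n.+2 = (lucas n.+1 + lucas n)%N.
Proof. by []. Qed.

Lemma fibD a d : fib (a + d).+1 = (fib a.+1 * fib d.+1 + fib a * fib d)%N.
Proof.
elim: d a => [|d IHd] a; first by rewrite addn0 muln0 muln1 addn0.
by rewrite -addSnnS IHd !fibSS; ring.
Qed.

(** The additive form avoids truncated subtraction. The two-step recurrence forces an induction on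
    two consecutive values. *)
Lemma lucas_fib n : (lucas n + fib n = 2 * fib n.+1)%N.
Proof.
suff [] : (lucas n + fib n = 2 * fib n.+1)%N /\
          (lucas n.+1 + fib n.+1 = 2 * fib n.+2)%N by [].
elim: n => [//|n [IHn IHn1]]; split=> //.
by rewrite lucasSS !fibSS in IHn1 *; lia.
Qed.

Lemma fib_gt0 n : (0 < n)%N -> (0 < fib n)%N.
Proof. by elim: n => // -[|n] // IHn _; rewrite fibSS ltn_addr ?IHn. Qed.

Lemma lucas_ge_gt0 n : (n <= lucas n)%N && (0 < lucas n)%N.
Proof.
(* Positivity is carried along because the bound at [n = 0] gives only [0 <= lucas 0], too weak for
   the recurrence. *)
suff [] : ((n <= lucas n) && (0 < lucas n))%N /\
          ((n.+1 <= lucas n.+1) && (0 < lucas n.+1))%N by [].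
by elim: n => // n [IHn IHn1]; split=> //; rewrite lucasSS; lia.
Qed.

Lemma lucas_ge n : (n <= lucas n)%N.
Proof. by have /andP[] := lucas_ge_gt0 n. Qed.

Lemma lucas_gt0 n : (0 < lucas n)%N.
Proof. by have /andP[] := lucas_ge_gt0 n. Qed.

Section RingIdentities.
Variable R : comNzRingType.

Lemma lucasE n : (lucas n)%:R = 2 * (fib n.+1)%:R - (fib n)%:R :> R.
Proof. by apply/eqP; rewrite eq_sym subr_eq -natrD lucas_fib natrM. Qed.

Lemma fib_cassini n :
  (fib n.+1)%:R ^+ 2 - (fib n)%:R * (fib n.+1)%:R - (fib n)%:R ^+ 2
  = (-1) ^+ n :> R.
Proof.
elim: n => [|n IHn]; first by rewrite /=; ring.
by rewrite fibSS natrD [RHS]exprS -IHn; ring.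
Qed.

Lemma fib_docagne a d :
  (fib (a + d))%:R * (lucas a)%:R - (fib a)%:R * (lucas (a + d))%:R
  = 2 * (-1) ^+ a * (fib d)%:R :> R.
Proof.
rewrite !lucasE -fib_cassini fibD.
(* For a successor [d], [fib (a + d)] also takes the shape that [fibD] expands; what remains is a
   polynomial identity. *)
case: d => [|d]; first by rewrite addn0 /=; ring.
by rewrite addnS fibD fibSS !(natrD, natrM); ring.
Qed.

Lemma lucas_sqr n :
  (lucas n)%:R ^+ 2 = 5 * (fib n)%:R ^+ 2 + 4 * (-1) ^+ n :> R.
Proof. by rewrite lucasE -fib_cassini; ring. Qed.

End RingIdentities.

Lemma cvg_alternating_sum (R : realType) (T : R^nat) (l : R) (q : nat) :
  ~~ odd q -> T @ \oo --> l ->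
  \sum_(i < q) (-1) ^+ i * T (N + i)%N @[N --> \oo] --> (0 : R).
Proof.
move=> q_even Tl.
have sum0 : \sum_(i < q) (-1) ^+ i * l = 0 :> R.
  rewrite -mulr_suml -[q]odd_double_half (negPf q_even) add0n.
  elim: q./2 => [|h IHh]; first by rewrite big_ord0 mul0r.
  (* The last two terms have opposite signs and cancel. *)
  rewrite doubleS !big_ord_recr /= exprS mulN1r addrK; exact: IHh.
rewrite -[X in _ --> X]sum0; apply: cvg_big => [|i _]; first exact: add_continuous.
apply: cvgMl_tmp.
by rewrite (cvg_shiftn i T).
Qed.

Section Limits.
Variable R : realType.

Definition fib_lucas (i : nat) : R := (fib i)%:R / (lucas i)%:R.

Lemma lucasr_neq0 i : (lucas i)%:R != 0 :> R.
Proof. by rewrite pnatr_eq0 -lt0n lucas_gt0. Qed.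

(** Dividing [lucas_sqr] by [5 L^2] gives [(F / L)^2 = 1/5 - (4/5) (-1)^i / L^2]. The last term
    vanishes in the limit because [L i >= i], and [F / L] is the nonnegative root. *)
Lemma cvg_fib_lucas : fib_lucas @ \oo --> Num.sqrt (5^-1 : R).
Proof.
have -> : fib_lucas = fun i => Num.sqrt (5^-1 - 4 / 5 *
    ((-1) ^+ i * (lucas i)%:R^-1 ^+ 2)).
  apply/funext => i.
  have -> : 5^-1 - 4 / 5 * ((-1) ^+ i * (lucas i)%:R^-1 ^+ 2)
      = fib_lucas i ^+ 2.
    have e : 4 * (-1) ^+ i = (lucas i)%:R ^+ 2 - 5 * (fib i)%:R ^+ 2 :> R.
      by rewrite lucas_sqr; ring.
    rewrite mulrAC mulrA e /fib_lucas; field.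
    exact: lucasr_neq0.
  by rewrite sqrtr_sqr ger0_norm // divr_ge0.
apply: (@continuous_cvg _ _ _ _ _ _ (@Num.sqrt R)); first exact: sqrt_continuous.
rewrite -[X in _ --> X]subr0 -[in X in _ --> X](mulr0 (4 / 5)).
apply: cvgB; first exact: cvg_cst.
apply: cvgMl_tmp; apply: norm_cvg0.
under eq_fun => i
  do rewrite normrM normrX normrN1 expr1n mul1r normrX ger0_norm ?invr_ge0//.
have lV0 : (lucas i)%:R^-1 @[i --> \oo] --> (0 : R).
  apply/(gtr0_cvgV0 (f := fun i => (lucas i)%:R : R)); last first.
    apply/cvgrnyP/cvgnyPge => A; near=> i.
    by apply: leq_trans (lucas_ge i); near: i; exact: nbhs_infty_ge.
  by near=> i; rewrite ltr0n lucas_gt0.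
by rewrite -(mulr0 (0 : R)); exact: cvgM.
Unshelve. all: by end_near.
Qed.

End Limits.

(** Sliding the window sum of [U] over [[k, k + q)] by one step adds [U (k + q)] and drops [U k], so
    the left side telescopes. *)
Lemma sum_shift_subr (V : zmodType) (U : nat -> V) (a b q : nat) :
  (a <= b)%N ->
  \sum_(a <= k < b) (U (k + q)%N - U k) =
  \sum_(i < q) U (b + i)%N - \sum_(i < q) U (a + i)%N.
Proof.
move=> ab; apply: (telescope_sumr_eq (fun k => \sum_(i < q) U (k + i)%N)) => //.
move=> k _; suff e : \sum_(i < q) U (k + i)%N + U (k + q)%N =
    U k + \sum_(i < q) U (k.+1 + i)%N.
  rewrite -[U (k + q)%N](addKr (\sum_(i < q) U (k + i)%N)) e.
  by rewrite addrC addrCA addKr addrC.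
under [in RHS]eq_bigr => i _ do rewrite addSnnS.
transitivity (\sum_(i < q.+1) U (k + i)%N); first by rewrite big_ord_recr.
by rewrite big_ord_recl addn0.
Qed.

Section FibLucasProd.
Variables (R : realType) (m n q : nat).

Let d := (m * n * q)%N.

Definition fib_lucas_prod (k : nat) : R :=
  \prod_(0 <= j < m) fib_lucas R (n * k + j * n * q).

Lemma cvg_fib_lucas_prod : (0 < n)%N ->
  fib_lucas_prod @ \oo --> \prod_(0 <= j < m) Num.sqrt (5^-1 : R).
Proof.
move=> n_gt0; apply: cvg_big => [|j _]; first exact: mul_continuous.
apply: cvg_comp (cvg_fib_lucas R).
apply/cvgnyPge => A; near=> k.
apply: (@leq_trans k); first by near: k; exact: nbhs_infty_ge.
by rewrite (leq_trans (leq_pmull k n_gt0)) ?leq_addr.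
Unshelve. all: by end_near.
Qed.

(** Replacing [k] by [k + q] shifts [j] by one, so the two products share the factors [1 <= j < m].
    The end factors [j = 0] and [j = m] differ by a d'Ocagne expression, their indices being [d]
    apart. *)
Lemma fib_lucas_prod_diff (k : nat) : (0 < m)%N -> odd n ->
  2 * (fib d)%:R *
    ((\prod_(1 <= j < m) (fib (n * k + j * n * q)%N)%:R) /
     (\prod_(0 <= j < m.+1) (lucas (n * k + j * n * q)%N)%:R)) =
  (-1) ^+ k * (fib_lucas_prod (k + q) - fib_lucas_prod k).
Proof.
move=> m_gt0 n_odd.
have -> : fib_lucas_prod (k + q) =
    \prod_(1 <= j < m.+1) fib_lucas R (n * k + j * n * q).
  rewrite big_add1; apply: eq_bigr => j _; congr (fib_lucas R); ring.
rewrite /fib_lucas_prod [in X in X - _]big_nat_recr//= [X in _ - X]big_ltn//.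
rewrite big_nat_recr//= [X in _ / (X * _)]big_ltn//.
rewrite prodf_div -/d !mul0n addn0 /fib_lucas.
have P0 : \prod_(1 <= j < m) (lucas (n * k + j * n * q))%:R != 0 :> R.
  by rewrite prodf_seq_neq0; apply/allP => j _; rewrite lucasr_neq0.
have e : 2 * (fib d)%:R = (-1) ^+ k * ((fib (n * k + d))%:R * (lucas (n * k))%:R
    - (fib (n * k))%:R * (lucas (n * k + d))%:R) :> R.
  (* One sign stays in front; the other is d'Ocagne's [(-1)^(n k)], equal to [(-1)^k] as [n] is
     odd. *)
  transitivity (((-1) ^+ k) ^+ 2 * (2 * (fib d)%:R) : R).
    by rewrite sqrr_sign mul1r.
  rewrite fib_docagne -[in RHS](signr_odd _ (n * k)) oddM n_odd signr_odd /=.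
  ring.
rewrite e; field.
by rewrite P0 !lucasr_neq0.
Qed.

End FibLucasProd.

Theorem theorem2p13 (R : realType) (m n q : nat)
    (m_gt0 : (0 < m)%N) (n_gt0 : (0 < n)%N) (q_gt0 : (0 < q)%N)
    (n_odd : odd n) (q_even : ~~ odd q) :
  (\sum_(1 <= k < N.+1)
      ((\prod_(1 <= j < m) (fib (n * k + j * n * q)%N)%:R) /
       (\prod_(0 <= j < m.+1) (lucas (n * k + j * n * q)%N)%:R)) : R)
    @[N --> \oo] -->
  (1 / (2 * (fib (m * n * q)%N)%:R) *
    \sum_(1 <= k < q.+1)
      ((-1) ^+ (k - 1)%N *
       \prod_(0 <= j < m)
         ((fib (n * k + j * n * q)%N)%:R / (lucas (n * k + j * n * q)%N)%:R))
   : R).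
Proof.
set c := 2 * (fib (m * n * q)%N)%:R : R.
have c0 : c != 0.
  by rewrite mulf_neq0 ?pnatr_eq0// -lt0n fib_gt0 ?muln_gt0 ?m_gt0 ?n_gt0.
pose T := fib_lucas_prod R m n q.
pose U k := (-1) ^+ k * T k.
have partial N : \sum_(1 <= k < N.+1)
      ((\prod_(1 <= j < m) (fib (n * k + j * n * q)%N)%:R) /
       (\prod_(0 <= j < m.+1) (lucas (n * k + j * n * q)%N)%:R)) =
    c^-1 * (\sum_(i < q) U (N.+1 + i)%N - \sum_(i < q) U (1 + i)%N) :> R.
  rewrite -sum_shift_subr// mulr_sumr; apply: eq_bigr => k _.
  apply: (mulfI c0); rewrite mulVKf// fib_lucas_prod_diff// mulrBr /U.
  (* As [q] is even, [U (k + q)] carries the same sign as [U k]. *)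
  by rewrite exprD -(signr_odd _ q) (negPf q_even) mulr1.
under eq_fun => N do rewrite partial.
rewrite mul1r; apply: cvgMl_tmp.
(* The sign [(-1)^(k - 1)] is opposite to that in [U k]; the [0] is the limit of the moving
   window. *)
have -> : \sum_(1 <= k < q.+1) ((-1) ^+ (k - 1)%N * \prod_(0 <= j < m)
      ((fib (n * k + j * n * q)%N)%:R / (lucas (n * k + j * n * q)%N)%:R))
    = 0 - \sum_(i < q) U (1 + i)%N :> R.
  rewrite sub0r -sumrN big_add1 big_mkord; apply: eq_bigr => i _.
  by rewrite subn1 /= /U add1n exprS mulN1r mulNr opprK.
apply: cvgB; last exact: cvg_cst.
(* The common sign [(-1)^(N + 1)] has no limit; absolute values remove it. *)
apply: norm_cvg0.
have -> : (fun N => `|\sum_(i < q) U (N.+1 + i)%N|) =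
    (fun N => `|\sum_(i < q) (-1) ^+ i * T (N.+1 + i)%N|).
  apply/funext => N; under eq_bigr => i _ do rewrite /U exprD -mulrA.
  by rewrite -mulr_sumr normrM normrX normrN1 expr1n mul1r.
have := cvg_alternating_sum _ _ _ _ q_even (cvg_fib_lucas_prod R m n q n_gt0).
rewrite -(cvg_shiftS (fun N => \sum_(i < q) (-1) ^+ i * T (N + i)%N)).
by move/cvg_norm; rewrite normr0.
Qed.
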